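(* Let $h(x)=\sum_{k\ge1}h_kx^k\in\mathbb{K}[[x]]$ with $h_k\ne0$ for all $k\ge1$, and set $h_0=0$. Let $(L_k^h)_{k\ge0}$ be the unique sequence of polynomials such that $\mathcal{D}_h(p)=\sum_{j\ge0}L_j^h(x)\,\mathcal{D}^{(j)}(p)$ for every polynomial $p$. Then for every $k\ge0$, $$L_k^h(x)=\frac{x^{k-1}}{k!}\sum_{j=0}^k(-1)^{k+j}\binom{k}{j}h_j.$$
   Context: $\mathbb{K}$ is a field of characteristic zero. The $h$-derivative is $\mathcal{D}_h\big(\sum_{k\ge0}s_kx^k\big)=\sum_{k\ge1}h_ks_kx^{k-1}$, so $\mathcal{D}_h(x^k)=h_kx^{k-1}$. $\mathcal{D}$ is the usual derivative and $\mathcal{D}^{(j)}$ its $j$-fold composition ($\mathcal{D}^{(0)}$ the identity). The defining identity applied to $x^k$ reads $h_kx^{k-1}=\sum_{j=0}^k\binom{k}{j}j!\,L_j^h(x)x^{k-j}$ for all $k\ge0$, which determines the $L_j^h$ uniquely (by a result of Sheffer they exist with $\deg L_k^h\le k-1$); the same expansion then holds on all of $\mathbb{K}[[x]]$. *)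

(* Defs.v *)
From mathcomp Require Import all_boot all_order all_algebra.

Set Implicit Arguments.
Unset Strict Implicit.
Unset Printing Implicit Defensive.

Import GRing.Theory.
Local Open Scope ring_scope.

Section HDerivative.

Variable K : fieldType.

(* h stands for the formal power series sum_k (h k) x^k. *)
Implicit Types (h : nat -> K) (L : nat -> {poly K}) (p : {poly K}).

Definition hderiv h p : {poly K} :=
  \poly_(i < (size p).-1) (h i.+1 * p`_i.+1).

(* The sum over all j >= 0 is cut at size p, since p^`(j) = 0 for
   j >= size p (derivn_poly0).  In characteristic zero exactly one L has this
   property: see hderiv_expansion_exists and hderiv_expansion_unique. *)
Definition hderiv_expansion h L : Prop :=
  forall p, hderiv h p = \sum_(j < size p) L j * p^`(j).

Lemma coef_hderiv h p i : (hderiv h p)`_i = h i.+1 * p`_i.+1.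
Proof.
rewrite coef_poly; case: ltnP => // le_p_i.
by rewrite nth_default ?mulr0 // (leq_trans (leqSpred _)).
Qed.

Lemma hderiv_sum h p n : (size p <= n)%N ->
  hderiv h p = \sum_(i < n) p`_i *: hderiv h 'X^i.
Proof.
move=> le_p_n; apply/polyP=> i; rewrite coef_hderiv coef_sum.
under eq_bigr => j _ do rewrite coefZ coef_hderiv coefXn.
case: (ltnP i.+1 n) => [lt_in | le_ni].
  rewrite (bigD1 (Ordinal lt_in)) //= eqxx mulr1 mulrC big1 ?addr0 // => j ne.
  case: eqP => [Ej|]; last by rewrite !mulr0.
  by case/eqP: ne; apply: val_inj.
rewrite nth_default ?(leq_trans le_p_n) // mulr0 big1 // => j _.
case: eqP => [Ej|]; last by rewrite !mulr0.
by have := ltn_ord j; rewrite -Ej ltnNge le_ni.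
Qed.

Lemma expansion_widen L p n : (size p <= n)%N ->
  \sum_(j < size p) L j * p^`(j) = \sum_(j < n) L j * p^`(j).
Proof.
move=> le_p_n; rewrite (big_ord_widen n (fun j => L j * p^`(j))) // big_mkcond.
apply: eq_bigr => j _; case: ltnP => // le_p_j.
by rewrite derivn_poly0 ?mulr0.
Qed.

Lemma derivn_monomials p n :
  p^`(n) = \sum_(i < size p) p`_i *: ('X^i)^`(n).
Proof.
rewrite -{1}[p]coefK poly_def linear_sum.
by apply: eq_bigr => i _; rewrite linearZ.
Qed.

Lemma hderiv_expansionXn h L :
  (forall k, hderiv h 'X^k = \sum_(j < k.+1) L j * ('X^k)^`(j)) ->
  hderiv_expansion h L.
Proof.
move=> LXn p; rewrite (hderiv_sum h (leqnn _)).
rewrite [in RHS](eq_bigr (fun j : 'I_(size p) =>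
  \sum_(i < size p) p`_i *: (L j * ('X^i)^`(j)))); last first.
  move=> j _; rewrite (derivn_monomials p j) mulr_sumr.
  by apply: eq_bigr => i _; rewrite scalerAr.
rewrite exchange_big; apply: eq_bigr => i _.
rewrite LXn -scaler_sumr; congr (_ *: _).
by have := @expansion_widen L 'X^i (size p); rewrite size_polyXn => ->.
Qed.

Fixpoint expansion_prefix h n : seq {poly K} :=
  if n is m.+1 then
    let s := expansion_prefix h m in
    rcons s (m`!%:R^-1 *: (hderiv h 'X^m - \sum_(j < m) s`_j * ('X^m)^`(j)))
  else [::].

Lemma size_expansion_prefix h n : size (expansion_prefix h n) = n.
Proof. by elim: n => //= n IHn; rewrite size_rcons IHn. Qed.

Lemma nth_expansion_prefix h n k : (k < n)%N ->
  (expansion_prefix h n)`_k = (expansion_prefix h k.+1)`_k.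
Proof.
elim: n => // n IHn; rewrite ltnS leq_eqVlt => /predU1P[-> // | lt_kn].
by rewrite [expansion_prefix h n.+1]/= nth_rcons size_expansion_prefix lt_kn IHn.
Qed.

Lemma derivnXn_diag k : ('X^k : {poly K})^`(k) = k`!%:R%:P.
Proof. by rewrite derivnXn ffactnn subnn expr0 polyC_natr. Qed.

Hypothesis charK0 : [pchar K] =i pred0.

Lemma fact_neq0 k : k`!%:R != 0 :> K.
Proof. by rewrite (pcharf0P _).1 // -lt0n fact_gt0. Qed.

Lemma hderiv_expansion_exists h : exists L, hderiv_expansion h L.
Proof.
pose L k := (expansion_prefix h k.+1)`_k.
exists L; apply: hderiv_expansionXn => k; rewrite big_ord_recr /= derivnXn_diag.
rewrite {2}/L /= nth_rcons size_expansion_prefix ltnn eqxx.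
rewrite mulrC mul_polyC scalerA mulfV ?fact_neq0 // scale1r.
under [X in _ - X]eq_bigr => j _ do rewrite nth_expansion_prefix //.
by rewrite addrC subrK.
Qed.

Lemma hderiv_expansion_unique h L M :
  hderiv_expansion h L -> hderiv_expansion h M -> L =1 M.
Proof.
move=> HL HM k; elim/ltn_ind: k => k IHk.
have := HM 'X^k; rewrite HL size_polyXn !big_ord_recr /= derivnXn_diag.
under eq_bigr => j _ do rewrite IHk //.
move/addrI; apply: mulIf; rewrite polyC_eq0; exact: fact_neq0.
Qed.

End HDerivative.

(* Main.v *)
Require Import Defs.
From mathcomp Require Import all_boot all_order all_algebra.

Import GRing.Theory.
Local Open Scope ring_scope.

(** Applied to [x^n], the expansion with the claimed coefficients collapses to
    [x^(n-1)] times a binomial transform of the alternating sums of [h], which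
    binomial inversion identifies with [h n]; uniqueness of the expansion then
    gives the formula. *)

Lemma coef_subX1_exp (R : comNzRingType) n i :
  (('X - 1 : {poly R}) ^+ n)`_i = (-1) ^+ (n + i) * 'C(n, i)%:R.
Proof.
rewrite -polyC1 addrC -polyCN exprDn coef_sum.
under eq_bigr => j _ do rewrite coefMn -polyC_exp coefCM coefXn.
have [lt_in | le_ni] := ltnP i n.+1; last first.
  rewrite bin_small // mulr0 big1 // => j _.
  by rewrite gtn_eqF ?mulr0 ?mul0rn // (leq_trans (ltn_ord j)).
rewrite (bigD1 (Ordinal lt_in)) //= eqxx mulr1 big1 ?addr0 => [|j ne_ji].
  (* The binomial theorem yields the sign [(-1) ^+ (n - i)]; for [i <= n] it depends only on parity,
     which [n + i] shares. *)
  by rewrite mulr_natr -(signr_odd _ (n - i)) oddB // -oddD signr_odd.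
by rewrite (negPf (_ : i != j)) ?mulr0 ?mul0rn // eq_sym.
Qed.

(* The inner sums are the values at [('X - 1) ^+ j] of the linear functional
   ['X^i |-> h i], so this is the binomial expansion of ['X^n] in powers of
   ['X - 1]. *)
Lemma binomial_inversion (R : comNzRingType) (h : nat -> R) n :
  \sum_(j < n.+1) 'C(n, j)%:R *
    (\sum_(i < j.+1) (-1) ^+ (j + i) * 'C(j, i)%:R * h i) = h n.
Proof.
have functionalX1 (j : 'I_n.+1) :
    \sum_(i < j.+1) (-1) ^+ (j + i) * 'C(j, i)%:R * h i
      = \sum_(i < n.+1) (('X - 1 : {poly R}) ^+ j)`_i * h i.
  (* A range independent of [j] lets the two sums be exchanged; the added terms have [j < i], so
     their coefficients vanish. *)
  rewrite (big_ord_widen n.+1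
    (fun i => (-1) ^+ (j + i) * 'C(j, i)%:R * h i)) // big_mkcond.
  apply: eq_bigr => i _; rewrite coef_subX1_exp; case: ltnP => // lt_ji.
  by rewrite bin_small // mulr0 mul0r.
under eq_bigr => j _ do rewrite functionalX1 mulr_sumr.
rewrite exchange_big /=.
have expandXn :
    'X^n = \sum_(j < n.+1) ('X - 1 : {poly R}) ^+ j *+ 'C(n, j).
  rewrite -{1}['X](subrK 1) addrC exprDn.
  by apply: eq_bigr => j _; rewrite expr1n mul1r.
transitivity (\sum_(i < n.+1) ('X^n : {poly R})`_i * h i).
  apply: eq_bigr => i _; rewrite expandXn coef_sum mulr_suml.
  by apply: eq_bigr => j _; rewrite coefMn mulrA mulr_natl.
rewrite big_ord_recr /= coefXn eqxx mul1r big1 ?add0r // => i _.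
by rewrite coefXn ltn_eqF ?mul0r.
Qed.

Lemma hderivXn (K : fieldType) (h : nat -> K) n :
  h 0%N = 0 -> hderiv h 'X^n = h n *: 'X^(n.-1).
Proof.
move=> h0; apply/polyP=> i; rewrite coef_hderiv coefZ !coefXn.
(* At [n = 0] the truncated exponent gives ['X^0], so [h 0 = 0] is what kills the right side. *)
case: n => [|n] /=; first by rewrite h0 mulr0 mul0r.
by rewrite eqSS; case: eqP => [->|]; rewrite ?mulr0.
Qed.

(* At k = 0 the truncated exponent k.-1 is harmless: the sum is h 0 = 0. *)
Theorem mainTheorem11 (K : fieldType) (charK0 : [pchar K] =i pred0)
    (h : nat -> K) (h0 : h 0%N = 0)
    (h_neq0 : forall k : nat, (1 <= k)%N -> h k != 0)
    (L : nat -> {poly K}) (HL : hderiv_expansion h L) (k : nat) :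
  L k = ((k`!%:R)^-1 * \sum_(j < k.+1) (-1) ^+ (k + j) * 'C(k, j)%:R * h j)
          *: 'X^(k.-1).
Proof.
pose d k := \sum_(j < k.+1) (-1) ^+ (k + j) * 'C(k, j)%:R * h j.
pose M k : {poly K} := ((k`!%:R)^-1 * d k) *: 'X^(k.-1).
suff HM : hderiv_expansion h M by exact: (hderiv_expansion_unique charK0 HL HM).
apply: hderiv_expansionXn => n.
rewrite hderivXn // -{1}[h n](binomial_inversion _ h) scaler_suml.
apply: eq_bigr => -[j /= lt_jn] _; rewrite -/(d j) /M.
rewrite derivnXn -bin_ffact.
(* The exponents [j.-1] and [n - j] add up to [n.-1] only for [j > 0]; the term [j = 0] vanishes
   since [d 0 = h 0 = 0]. *)
case: j lt_jn => [|j] lt_jn.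
  by rewrite /d big_ord1 h0 !mulr0 !scale0r mul0r.
rewrite -scaler_nat -scalerAr -scalerAl -exprD scalerA natrM.
have -> : (j.+1.-1 + (n - j.+1) = n.-1)%N.
  by case: n lt_jn => // n lt_jn; rewrite subSS /= subnKC.
by rewrite -mulrA mulVKf ?fact_neq0.
Qed.
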